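(* Let $n\ge 1$ be an odd integer. Then the image of the map $\mathbb{F}_{2^n}\to\mathbb{F}_{2^n}$, $x\mapsto x^3+x$, is the disjoint union $$\mathrm{Im}(x^3+x)=\{0\}\sqcup Y_1^{(n)}\sqcup Y_3^{(n)},$$ where $$Y_1^{(n)}=\{\xi\in\mathbb{F}_{2^n}\setminus\{0\}\mid \mathrm{Tr}(\xi^{-1})=0\},\qquad Y_3^{(n)}=\{s+s^{-1}\mid s\in U_{(2^n+1)/3},\ s\neq 1\}.$$
   Context: For $x\in\mathbb{F}_{2^n}$, $\mathrm{Tr}(x)=\sum_{i=0}^{n-1}x^{2^i}$ is the absolute trace, with values in $\mathbb{F}_2=\{0,1\}$. For $i\in\{0,1,3\}$, $Y_i^{(n)}$ denotes the set of $\xi\in\mathbb{F}_{2^n}$ such that the polynomial $x^3+x-\xi$ has exactly $i$ distinct roots in $\mathbb{F}_{2^n}$. The displayed formulas for $Y_1^{(n)}$ and $Y_3^{(n)}$ are part of the assertion. $U_d=\{x\mid x^d=1\}$ is the group of $d$-th roots of unity; here $U_{(2^n+1)/3}$ is taken in $\mathbb{F}_{2^{2n}}^*$, where $\mathbb{F}_{2^{2n}}$ is the quadratic extension of $\mathbb{F}_{2^n}$ (for odd $n$, $3$ divides $2^n+1$), and the elements $s+s^{-1}$ are regarded as elements of the subfield $\mathbb{F}_{2^n}\subset\mathbb{F}_{2^{2n}}$. *)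

(* Defs.v *)
From HB Require Import structures.
From mathcomp Require Import all_boot all_order all_algebra.

Set Implicit Arguments.
Unset Strict Implicit.
Unset Printing Implicit Defensive.

Import GRing.Theory.
Local Open Scope ring_scope.

(* The field F_{2^n} is any finite field F with #|F| = 2 ^ n.  The trace takes
   its values in the prime subfield {0, 1} of F. *)
Definition Tr (F : finFieldType) (n : nat) (x : F) : F :=
  \sum_(i < n) x ^+ (2 ^ i)%N.

Definition Y (F : finFieldType) (i : nat) : {set F} :=
  [set xi : F | #|[set x : F | root ('X^3 + 'X - xi%:P) x]| == i].

(* For d > 0 the members are nonzero, so this is a subset of K^*. *)
Definition U (K : finFieldType) (d : nat) : {set K} :=
  [set x : K | x ^+ d == 1].

Arguments Tr {F} n x.

(* Main.v *)
(** For xi != 0 and a root x of X^3 + X = xi one has x != 0, 1, and the other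
roots are the x z with z^2 + z = 1 + x^-2.  Such a z exists in F iff
Tr (1 + x^-2) = 1 + Tr x^-1 vanishes (n is odd), so xi has three preimages if
Tr x^-1 = 1 and a single one if Tr x^-1 = 0.  As
1 / (x^3 + x) = 1 / x + 1 / (x + 1) + 1 / (x + 1)^2 gives
Tr (x^3 + x)^-1 = Tr x^-1, the map x |-> x^3 + x permutes the set
{x != 0, Tr x^-1 = 0}, which is therefore Y_1.  The parametrization of Y_3 comes
from (t + t^-1)^3 + (t + t^-1) = t^3 + t^-3 with t^(2^n + 1) = 1. *)
Require Import Defs.
From HB Require Import structures.
From mathcomp Require Import all_boot all_order all_algebra.
From mathcomp Require Import cyclic finfield ring zify.

Set Implicit Arguments.
Unset Strict Implicit.
Unset Printing Implicit Defensive.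

Import GRing.Theory.
Local Open Scope ring_scope.

(** * Identities in characteristic 2 *)

Lemma sqrD_pchar2 (R : comNzRingType) (x y : R) :
  2 \in [pchar R] -> (x + y) ^+ 2 = x ^+ 2 + y ^+ 2.
Proof. by move=> ch; rewrite sqrrD mulrn_pchar ?addr0. Qed.

Lemma exp2D_pchar2 (R : comNzRingType) (i : nat) (x y : R) :
  2 \in [pchar R] -> (x + y) ^+ (2 ^ i) = x ^+ (2 ^ i) + y ^+ (2 ^ i).
Proof.
move=> ch; elim: i => [|i IH]; first by rewrite !expr1.
by rewrite expnSr !exprM IH sqrD_pchar2.
Qed.

Lemma addr_eq0_pchar2 (R : comNzRingType) (x y : R) :
  2 \in [pchar R] -> (x + y == 0) = (x == y).
Proof. by move=> ch; rewrite addr_eq0 oppr_pchar2. Qed.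

Lemma cubic_fact (R : comNzRingType) (x : R) :
  2 \in [pchar R] -> x ^+ 3 + x = x * (x + 1) ^+ 2.
Proof. by move=> ch; rewrite sqrD_pchar2 //; ring. Qed.

Lemma cubic_eq (R : comNzRingType) (x y : R) :
  2 \in [pchar R] -> (x ^+ 3 + x == y ^+ 3 + y)
    = ((x + y) * (x ^+ 2 + x * y + y ^+ 2 + 1) == 0).
Proof.
move=> ch; have h2 : 2%:R = 0 :> R by apply: pcharf0.
rewrite -(addr_eq0_pchar2 _ _ ch).
(* [ring] and [field] do not know the characteristic: here and below, identities are stated with an
   explicit multiple of [2%:R] that makes them hold over the integers. *)
have -> : x ^+ 3 + x + (y ^+ 3 + y) =
   (x + y) * (x ^+ 2 + x * y + y ^+ 2 + 1) - 2%:R * (x ^+ 2 * y + x * y ^+ 2).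
  by ring.
by rewrite h2 mul0r subr0.
Qed.

Lemma addV_cube_pchar2 (K : fieldType) (t : K) : 2 \in [pchar K] -> t != 0 ->
  (t + t^-1) ^+ 3 + (t + t^-1) = t ^+ 3 + (t ^+ 3)^-1.
Proof.
move=> ch t0; have h2 : 2%:R = 0 :> K by apply: pcharf0.
have -> : (t + t^-1) ^+ 3 + (t + t^-1)
        = t ^+ 3 + (t ^+ 3)^-1 + 2%:R * (2%:R * (t + t^-1)) by field.
by rewrite h2 mul0r addr0.
Qed.

Lemma addV_eq (K : fieldType) (t u : K) : t != 0 -> u != 0 ->
  (t + t^-1 == u + u^-1) = (t == u) || (t * u == 1).
Proof.
move=> t0 u0; rewrite -subr_eq0.
have -> : t + t^-1 - (u + u^-1) = (t - u) * (t * u - 1) / (t * u).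
  by field; rewrite t0 u0.
by rewrite !mulf_eq0 invr_eq0 (mulf_eq0 t u) (negPf t0) (negPf u0) !orbF
           !subr_eq0.
Qed.

(** * Finite fields: primitive roots and recognition of a subfield *)

Lemma finField_has_prim_root (K : finFieldType) :
  exists z : K, #|K|.-1.-primitive_root z.
Proof.
have /hasP[z _ hz] : has #|K|.-1.-primitive_root (enum [pred x : K | x != 0]).
  apply: has_prim_root.
  - by have := finNzRing_gt1 K; case: #|K| => [|[]].
  - apply/allP => x; rewrite mem_enum inE => x0; rewrite unity_rootE.
    have /eqP := expf_card x.
    rewrite -{1}(prednK (ltnW (finNzRing_gt1 K))) exprS -subr_eq0.
    by rewrite -[X in _ - X]mulr1 -mulrBr mulf_eq0 (negPf x0) subr_eq0.
  - exact: enum_uniq.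
  - by rewrite -cardE [X in (_ <= X)%N](cardC1 (0 : K)).
by exists z.
Qed.

(** Transporting [X^q - X = \prod_x (X - x)] along [f] and evaluating at [y] gives a vanishing
    product, so one factor [y - f x] is zero. *)
Lemma expf_card_rmorph_im (F : finFieldType) (K : fieldType)
  (f : {rmorphism F -> K}) (y : K) : y ^+ #|F| = y -> exists x, y = f x.
Proof.
move=> yq.
have : \prod_(x : F) (y - f x) = 0.
  have := congr1 (fun p => (map_poly f p).[y]) (finField_genPoly F).
  rewrite rmorphB rmorphXn /= map_polyX hornerD hornerN hornerXn hornerX yq
          subrr.
  rewrite rmorph_prod horner_prod => /esym; congr (_ = _).
  by apply: eq_bigr => x _; rewrite rmorphB /= map_polyX map_polyC !hornerE.
move/eqP/prodf_eq0 => [x _ /eqP/subr0_eq ->].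
by exists x.
Qed.

(** * The absolute trace for odd [n] *)

Section Trace.
Variables (F : finFieldType) (n : nat).
Hypotheses (n_odd : odd n) (hF : #|F| = (2 ^ n)%N).

Let ch : 2 \in [pchar F].
Proof. exact: card_finPcharP hF _. Qed.

Let h2 : 2%:R = 0 :> F.
Proof. exact: pcharf0. Qed.

Lemma TrD (x y : F) : Tr n (x + y) = Tr n x + Tr n y.
Proof.
by rewrite /Tr -big_split; apply: eq_bigr => i _; rewrite exp2D_pchar2.
Qed.

Lemma Tr_sqrE (x : F) : Tr n (x ^+ 2) = Tr n x ^+ 2.
Proof.
rewrite /Tr; elim: n => [|m IH]; first by rewrite !big_ord0 expr0n.
by rewrite !big_ord_recr /= sqrD_pchar2 // IH -!exprM mulnC.
Qed.

Lemma Tr_sqr (x : F) : Tr n (x ^+ 2) = Tr n x.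
Proof.
(* The sum of the first [n + 1] conjugates, split at its last and at its first term; the two extra
   terms agree because [x^(2^n) = x]. *)
have E : Tr n x + x ^+ (2 ^ n) = x + Tr n (x ^+ 2).
  transitivity (\sum_(i < n.+1) x ^+ (2 ^ i)); first by rewrite big_ord_recr.
  rewrite big_ord_recl expr1.
  by congr (_ + _); apply: eq_bigr => i _; rewrite -exprM -expnS.
by move: E; rewrite -hF expf_card addrC => /addrI.
Qed.

Lemma Tr_neq0 (x : F) : (Tr n x != 0) = (Tr n x == 1).
Proof.
apply/idP/eqP => [t0|->]; last exact: oner_neq0.
by apply: (mulfI t0); rewrite -expr2 -Tr_sqrE Tr_sqr mulr1.
Qed.

Lemma Tr1 : Tr n (1 : F) = 1.
Proof.
rewrite /Tr (eq_bigr (fun=> 1)) => [|i _]; last by rewrite expr1n.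
by rewrite sumr_const card_ord -(odd_double_half n) n_odd -mul2n mulrnDr
           mulrnA h2 mul0rn addr0.
Qed.

(* As n is odd, the half-trace of c is an explicit solution. *)
Lemma Tr0_ex (c : F) : Tr n c = 0 -> exists z, z ^+ 2 + z = c.
Proof.
move=> c0; exists (\sum_(i < n./2.+1) c ^+ (2 ^ i.*2)).
have E m : (\sum_(i < m) c ^+ (2 ^ i.*2)) ^+ 2 + \sum_(i < m) c ^+ (2 ^ i.*2)
         = \sum_(i < m.*2) c ^+ (2 ^ i).
  elim: m => [|m IH]; first by rewrite !big_ord0 expr0n addr0.
  rewrite doubleS !big_ord_recr /= sqrD_pchar2 // -IH -exprM -expnSr.
  by ring.
(* The sum has one term more than the trace: the trace of [c] vanishes and the extra term [c^(2^n)]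
   is [c]. *)
have n2 : n./2.+1.*2 = n.+1.
  by rewrite doubleS -[in RHS](odd_double_half n) n_odd.
rewrite E n2 big_ord_recr /= -/(Tr n c) c0 add0r -hF.
exact: expf_card.
Qed.

(** The cofactor [x^2 + x y + y^2 + 1] must vanish. Divided by [x^2], this reads
    [x^-2 = u^2 + u + 1] with [u = y / x], and the traces of [u^2] and [u] cancel. *)
Lemma cubic_collision (x y : F) : x != 0 -> x != y ->
  x ^+ 3 + x = y ^+ 3 + y -> Tr n x^-1 = 1.
Proof.
move=> x0 xy /eqP; rewrite cubic_eq // mulf_eq0 addr_eq0_pchar2 // (negPf xy).
move=> /eqP E.
have -> : Tr n x^-1 = Tr n ((y / x) ^+ 2 + y / x + 1).
  rewrite -Tr_sqr; congr (Tr n _).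
  transitivity (x^-1 ^+ 2 * (1 - (x ^+ 2 + x * y + y ^+ 2 + 1))
                + 2%:R * ((y / x) ^+ 2 + y / x + 1)).
    by rewrite E h2 mul0r addr0 subr0 mulr1.
  by field.
by rewrite !TrD Tr_sqr Tr1 addrr_pchar2 ?add0r.
Qed.

Lemma Tr_inv_cubic (x : F) : x ^+ 3 + x != 0 ->
  Tr n (x ^+ 3 + x)^-1 = Tr n x^-1.
Proof.
rewrite (cubic_fact x ch) mulf_eq0 expf_eq0 /= negb_or => /andP[x0 x1].
have -> : (x * (x + 1) ^+ 2)^-1 = x^-1 + ((x + 1)^-1 + (x + 1)^-1 ^+ 2).
  transitivity (x^-1 + ((x + 1)^-1 + (x + 1)^-1 ^+ 2)
                - 2%:R * (x * (x + 2%:R) / (x * (x + 1) ^+ 2))).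
    by field; rewrite x0 x1.
  by rewrite h2 mul0r subr0.
by rewrite !TrD Tr_sqr addrr_pchar2 ?addr0.
Qed.

(** * Fibre sizes of [x^3 + x] over [F] *)

Definition cubic_fiber (xi : F) : {set F} := [set x | x ^+ 3 + x == xi].

Lemma YE (i : nat) (xi : F) : (xi \in Y F i) = (#|cubic_fiber xi| == i).
Proof.
rewrite inE; congr (_ == _); apply: eq_card => x.
by rewrite !inE rootE !hornerE subr_eq0.
Qed.

(** The factorization [x (x + 1)^2] has a double root at 1, so 0 has exactly two preimages; this is
    what separates 0 from [Y F 1] and [Y F 3]. *)
Lemma Y_0 (i : nat) : (0 \in Y F i) = (i == 2).
Proof.
rewrite YE; have -> : cubic_fiber 0 = [set 0; 1].
  apply/setP => y; rewrite !inE cubic_fact //.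
  by rewrite mulf_eq0 expf_eq0 /= addr_eq0_pchar2.
by rewrite cards2 [0 == _]eq_sym oner_eq0 eq_sym.
Qed.

Lemma mem_Y1 (x : F) : x != 0 -> Tr n x^-1 = 0 -> x ^+ 3 + x \in Y F 1.
Proof.
move=> x0 Tx; rewrite YE; apply/cards1P; exists x; apply/setP => y.
rewrite !inE; apply/eqP/eqP => [E|-> //].
apply/eqP; case: eqVneq => // yx; move: (oner_neq0 F).
by rewrite -(@cubic_collision x y) // ?Tx ?eqxx // eq_sym.
Qed.

Lemma mem_Y3 (x : F) : x ^+ 3 + x != 0 -> Tr n x^-1 = 1 -> x ^+ 3 + x \in Y F 3.
Proof.
rewrite {1}(cubic_fact x ch) mulf_eq0 expf_eq0 /= negb_or => /andP[x0 x1] Tx.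
have [z hz] : exists z, z ^+ 2 + z = 1 + x^-1 ^+ 2.
  by apply: Tr0_ex; rewrite TrD Tr1 Tr_sqr Tx addrr_pchar2.
(* The right-hand side is [(1 + x^-1)^2], nonzero since [x != 1]. Hence [z] is neither 0 nor 1, and
   the roots [x], [x z], [x (z + 1)] are distinct. *)
have z0 : z ^+ 2 + z != 0.
  rewrite hz -(expr1n _ 2) -sqrD_pchar2 // expf_eq0 /= addr_eq0_pchar2 //.
  by rewrite eq_sym invr_eq1 -addr_eq0_pchar2.
have z0' : z != 0 by apply: contraNneq z0 => ->; rewrite expr0n addr0.
have fiberE : cubic_fiber (x ^+ 3 + x) = [set x; x * (z + 1) ; x * z].
  apply/setP => y; rewrite !inE eq_sym cubic_eq //.
  have -> : x ^+ 2 + x * y + y ^+ 2 + 1 = (y + x * z) * (y + x * (z + 1)).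
    transitivity ((y + x * z) * (y + x * (z + 1)) - 2%:R * (x * y * z)
                  - x ^+ 2 * (z ^+ 2 + z - (1 + x^-1 ^+ 2))); first by field.
    by rewrite hz h2 mul0r subrr mulr0 !subr0.
  rewrite !mulf_eq0 !addr_eq0_pchar2 // (eq_sym x).
  by case: (y == x); case: (y == x * z); rewrite ?orbT ?orbF.
rewrite YE fiberE setUC cardsU1 cards2 !inE negb_or.
have z1 : z != 1 by apply: contraNneq z0 => ->; rewrite expr1n addrr_pchar2.
have xz u : (x == x * u) = (u == 1).
  by rewrite -{1}(mulr1 x) (inj_eq (mulfI x0)) eq_sym.
rewrite (eq_sym (x * z)) !xz (inj_eq (mulfI x0)) z1.
by rewrite -{1}(addr0 z) (inj_eq (addrI z)) [0 == _]eq_sym oner_eq0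
           -[X in (_ + 1 != X)]add0r (inj_eq (addIr 1)) z0'.
Qed.

Lemma Y1_Tr (xi : F) : (xi \in Y F 1) = (xi != 0) && (Tr n xi^-1 == 0).
Proof.
pose A := [set x : F | (x != 0) && (Tr n x^-1 == 0)].
have A3 x : x \in A -> x ^+ 3 + x != 0.
  rewrite inE => /andP[x0 /eqP Tx].
  rewrite cubic_fact // mulf_eq0 (negPf x0) expf_eq0 /= addr_eq0_pchar2 //.
  by apply: contra_eqN Tx => /eqP ->; rewrite invr1 Tr1 oner_neq0.
have injA : {in A &, injective (fun x : F => x ^+ 3 + x)}.
  move=> x y; rewrite !inE => /andP[x0 /eqP Tx] _ E.
  case: (eqVneq x y) => // xy; move: (oner_neq0 F).
  by rewrite -(cubic_collision x0 xy E) Tx eqxx.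
(* An injective self-map of a finite set is onto, so it suffices to show that [A] is stable. *)
have imA : [set x ^+ 3 + x | x in A] = A.
  apply/eqP; rewrite eqEcard card_in_imset // leqnn andbT.
  apply/subsetP => _ /imsetP[x xA ->]; have x3 := A3 x xA.
  by rewrite inE x3 Tr_inv_cubic //; move: xA; rewrite inE => /andP[].
have -> : (xi != 0) && (Tr n xi^-1 == 0) = (xi \in A) by rewrite inE.
apply/idP/idP => [xiY|]; last first.
  rewrite -imA => /imsetP[x]; rewrite inE => /andP[x0 /eqP Tx] ->.
  exact: mem_Y1.
have := xiY; rewrite YE => /cards1P[x fx].
have /eqP Ex : x ^+ 3 + x == xi by have := set11 x; rewrite -fx inE.
have xi0 : xi != 0 by apply: contraTneq xiY => ->; rewrite Y_0.
rewrite inE xi0 -Ex Tr_inv_cubic ?Ex //=.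
(* If the trace were 1, [xi] would have three preimages instead of one. *)
apply: contraT; rewrite Tr_neq0 => /eqP Tx.
have := @mem_Y3 x; rewrite Ex => /(_ xi0 Tx).
by move: xiY; rewrite !YE => /eqP ->.
Qed.

Lemma Y_preimage (i : nat) (xi : F) : (0 < i)%N -> xi \in Y F i ->
  exists x, xi = x ^+ 3 + x.
Proof.
move=> i0; rewrite YE => /eqP Ei; move: i0; rewrite -Ei => /card_gt0P[x].
by rewrite inE => /eqP <-; exists x.
Qed.

Lemma cubic_Y (x : F) : x ^+ 3 + x != 0 ->
  if Tr n x^-1 == 0 then x ^+ 3 + x \in Y F 1 else x ^+ 3 + x \in Y F 3.
Proof.
move=> x3; case: ifPn => [/eqP|]; last first.
  by rewrite Tr_neq0 => /eqP; apply: mem_Y3.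
by apply: mem_Y1; apply: contraNneq x3 => ->; rewrite expr0n addr0.
Qed.
End Trace.

(** * Roots of unity in the quadratic extension and the set [Y F 3] *)

Section QuadraticExtension.
Variables (n : nat) (F K : finFieldType) (iota : {rmorphism F -> K}).
Hypotheses (n_odd : odd n) (hF : #|F| = (2 ^ n)%N).
Hypothesis (hK : #|K| = (2 ^ (2 * n))%N).

Let chF : 2 \in [pchar F].
Proof. exact: card_finPcharP hF _. Qed.

Let ch : 2 \in [pchar K].
Proof. exact: card_finPcharP hK _. Qed.

Let d := ((2 ^ n + 1) %/ 3)%N.

Let q2 : (2 <= 2 ^ n)%N.
Proof. by rewrite -[X in (X <= _)%N](expn1 2) leq_exp2l // odd_gt0. Qed.

Let d3 : (3 * d = 2 ^ n + 1)%N.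
Proof.
(* Oddness gives [2^n = 2 * 4^k], which is 2 modulo 3. *)
rewrite mulnC divnK // -(odd_double_half n) n_odd add1n expnS -mul2n expnM.
by rewrite /dvdn -modnDml -modnMmr -modnXm exp1n.
Qed.

Let cardK : #|K|.-1 = (3 * d * (2 ^ n - 1))%N.
Proof. by rewrite hK d3 mul2n -addnn expnD; have := expn_gt0 2 n; nia. Qed.

(** A primitive cube root of unity satisfies both equations, the second because [3 * d] is a
    multiple of 3. It serves to solve an equation [v^2 + v = c] with [c] of trace 1, and to produce
    a second preimage. *)
Lemma cube_root_of_unity : exists w : K, w ^+ 2 + w = 1 /\ w ^+ (3 * d) = 1.
Proof.
have [z hz] := finField_has_prim_root K.
exists (z ^+ (d * (2 ^ n - 1))); set w := z ^+ _.
have w3 : w ^+ 3 = 1.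
  by rewrite -exprM [X in z ^+ X](_ : _ = #|K|.-1) ?prim_expr_order // cardK; lia.
split; last by rewrite exprM w3 expr1n.
have w1 : w != 1.
  by rewrite -(prim_order_dvd hz) cardK gtnNdvd //; have := q2; have := d3; nia.
have : (w - 1) * (w ^+ 2 + w + 1) == 0.
  by apply/eqP; transitivity (w ^+ 3 - 1); [ring | rewrite w3 subrr].
by rewrite mulf_eq0 subr_eq0 (negPf w1) /= addr_eq0_pchar2 // => /eqP.
Qed.

(** In the cyclic group of [K] generated by [z], [s = z^i] with [s^d = 1] forces [3 (2^n - 1)] to
    divide [i]; then [t = z^(i/3)]. *)
Lemma cube_root_in_U (s : K) :
  s ^+ d = 1 -> exists2 t, t ^+ (3 * d) = 1 & s = t ^+ 3.
Proof.
have [z hz] := finField_has_prim_root K.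
move=> sd; have /(prim_rootP hz)[i sE] : s ^+ #|K|.-1 = 1.
  by rewrite cardK [(3 * d)%N]mulnC -mulnA exprM sd expr1n.
have d0 : (0 < d)%N by have := d3; lia.
have /dvdnP[k ik] : (3 * (2 ^ n - 1) %| i)%N.
  rewrite -(dvdn_pmul2r d0) mulnAC -cardK.
  by rewrite (prim_order_dvd hz) exprM -sE sd.
exists (z ^+ (k * (2 ^ n - 1))).
  rewrite -exprM -mulnA [(_ * (3 * d))%N]mulnC -cardK mulnC exprM.
  by rewrite (prim_expr_order hz) expr1n.
by rewrite sE -exprM ik; congr (z ^+ _); lia.
Qed.

Lemma iota_Y3 :
  iota @: Y F 3 = [set s + s^-1 | s in U K d & s != 1].
Proof.
have [w [hw wd]] := cube_root_of_unity.
have w0 : w != 0.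
  by apply: contra_eqN hw => /eqP ->; rewrite expr0n addr0 eq_sym oner_neq0.
(* Since [3 d = 2^n + 1], the Frobenius of [K] over [F] acts as inversion on these [t]; it therefore
   fixes [t + t^-1], which must come from [F]. *)
have q_d (t : K) : t ^+ (3 * d) = 1 -> t != 0 /\ t ^+ (2 ^ n) = t^-1.
  rewrite d3 exprD expr1 => tt; have t0 : t != 0.
    by apply: contra_eqN tt => /eqP ->; rewrite mulr0 eq_sym oner_neq0.
  by split=> //; apply: (mulIf t0); rewrite tt mulVf.
have in_F (t : K) : t ^+ (3 * d) = 1 -> exists x, t + t^-1 = iota x.
  case/q_d => t0 tq; apply: expf_card_rmorph_im.
  by rewrite hF exp2D_pchar2 // exprVn tq invrK addrC.
apply/setP => eta; apply/imsetP/imsetP => [[xi xiY ->]|[s]].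
- have [x xiE] := Y_preimage (isT : 0 < 3)%N xiY; have xi0 : xi != 0.
    by apply: contraTneq xiY => ->; rewrite (Y_0 hF).
  have x0 : x != 0 by apply: contraNneq xi0 => x0; rewrite xiE x0 expr0n addr0.
  have Tx : Tr n x^-1 = 1.
    apply/eqP; rewrite -(Tr_neq0 hF); apply: contraTneq xiY => Tx.
    by have := mem_Y1 n_odd hF x0 Tx; rewrite -xiE !YE => /eqP ->.
  have [z hz] : exists z, z ^+ 2 + z = 1 + x^-1 ^+ 2.
    by apply: (Tr0_ex n_odd hF); rewrite (TrD hF) (Tr1 n_odd hF) (Tr_sqr hF)
                                         Tx addrr_pchar2.
  (* The aim is [t + t^-1 = x]. With [t = x v] this becomes [v^2 + v = x^-2], whose right-hand side
     has trace 1; as [z] solves the equation for [1 + x^-2] and [w] the one for 1, [v = z + w]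
     works. *)
  pose t := iota x * (iota z + w).
  have ix0 : iota x != 0 by rewrite fmorph_eq0.
  have hzw : (iota z + w) ^+ 2 + (iota z + w) = (iota x)^-1 ^+ 2.
    rewrite sqrD_pchar2 // addrACA hw -rmorphXn -rmorphD hz rmorphD rmorph1 /=.
    by rewrite addrAC addrr_pchar2 // add0r rmorphXn fmorphV.
  have tt : t * (t + iota x) = 1.
    transitivity (iota x ^+ 2 * ((iota z + w) ^+ 2 + (iota z + w))).
      by rewrite /t; ring.
    by rewrite hzw -exprMn mulfV // expr1n.
  have t0 : t != 0.
    by apply: contra_eqN tt => /eqP ->; rewrite mul0r eq_sym oner_neq0.
  have tV : t^-1 = t + iota x by apply: (mulfI t0); rewrite tt mulfV.
  have wq : w ^+ (2 ^ n) = w + 1.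
    have [_ ->] := q_d _ wd; apply: (mulfI w0); rewrite mulfV //.
    by rewrite mulrDr mulr1 -expr2 hw.
  (* The Frobenius fixes [x] and [z] and sends [w] to [w + 1], hence [t] to [t + x = t^-1]. *)
  have td : t ^+ (3 * d) = 1.
    rewrite d3 exprD expr1 mulrC -[RHS]tt; congr (_ * _).
    rewrite exprMn exp2D_pchar2 // wq -!rmorphXn -hF !expf_card /t.
    by ring.
  have xE : iota x = t + t^-1 by rewrite tV addrA addrr_pchar2 ?add0r.
  have xiE' : iota xi = t ^+ 3 + (t ^+ 3)^-1.
    by rewrite xiE rmorphD rmorphXn /= xE addV_cube_pchar2.
  exists (t ^+ 3) => //; rewrite !inE -exprM td eqxx /=.
  apply: contraNneq xi0 => t3; rewrite -(fmorph_eq0 iota) xiE' t3 invr1.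
  by rewrite addrr_pchar2.
- rewrite !inE => /andP[/eqP sd s1] ->.
  have [t td sE] := cube_root_in_U sd.
  have [t0 _] := q_d _ td; have wt0 : w * t != 0 by rewrite mulf_neq0.
  (* [t] and [w t] have the same cube [s], so they yield two preimages [x] and [y] of one element of
     [F]; by the collision lemma their being distinct forces trace 1. *)
  have [x xE] := in_F _ td.
  have [y yE] : exists y, w * t + (w * t)^-1 = iota y.
    by apply: in_F; rewrite exprMn wd td mulr1.
  have w3 : w ^+ 3 = 1.
    have w1 : w + 1 = w ^+ 2 by rewrite -hw addrCA addrr_pchar2 ?addr0.
    by rewrite exprS -w1 mulrDr mulr1 -expr2 hw.
  have imx : iota (x ^+ 3 + x) = s + s^-1.
    by rewrite rmorphD rmorphXn /= -xE addV_cube_pchar2 // sE.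
  have imy : iota (y ^+ 3 + y) = s + s^-1.
    by rewrite rmorphD rmorphXn /= -yE addV_cube_pchar2 // exprMn w3 mul1r sE.
  (* Equality would mean [w = 1], or [w t^2 = 1], whose cube is [s^2 = 1]; in characteristic 2 the
     latter gives [s = 1]. *)
  have xy : x != y.
    rewrite -(inj_eq (fmorph_inj iota)) -xE -yE addV_eq // negb_or.
    apply/andP; split.
      rewrite -{1}(mul1r t) (inj_eq (mulIf t0)).
      apply: contra_eqN hw => /eqP <-.
      by rewrite expr1n addrr_pchar2 // eq_sym oner_neq0.
    apply: contraNneq s1 => /(congr1 (fun u => u ^+ 3)).
    rewrite !exprMn w3 mul1r expr1n -sE => /eqP.
    by rewrite -expr2 sqrf_eq1 oppr_pchar2 // orbb.
  exists (x ^+ 3 + x); last by rewrite imx.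
  have xi0 : x ^+ 3 + x != 0.
    rewrite -(fmorph_eq0 iota) imx addr_eq0_pchar2 //.
    apply: contraNneq s1 => sV; rewrite -(orbb (s == 1)) -{2}(oppr_pchar2 ch 1).
    by rewrite -sqrf_eq1 expr2 {2}sV mulfV // sE expf_neq0 //.
  have x0 : x != 0 by apply: contraNneq xi0 => ->; rewrite expr0n addr0.
  apply: (mem_Y3 n_odd hF xi0); apply: (cubic_collision n_odd hF x0 xy).
  by apply: (fmorph_inj iota); rewrite imx imy.
Qed.
End QuadraticExtension.

(* K, with the embedding iota, is the quadratic extension of F; the description
   of Y F 3 is an equality of subsets of K, so it includes the assertion that
   every s + s^-1 lies in the subfield F. *)
Theorem theorem4 (n : nat) (hn : (1 <= n)%N) (hodd : odd n)
    (F : finFieldType) (hF : #|F| = (2 ^ n)%N)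
    (K : finFieldType) (hK : #|K| = (2 ^ (2 * n))%N)
    (iota : {rmorphism F -> K}) :
  [/\ [set x ^+ 3 + x | x : F] = [set 0] :|: Y F 1 :|: Y F 3,
      [/\ [disjoint [set 0] & Y F 1],
          [disjoint [set 0] & Y F 3]
        & [disjoint Y F 1 & Y F 3]],
      Y F 1 = [set xi : F | xi != 0 & Tr n xi^-1 == 0]
    & iota @: Y F 3
      = [set s + s^-1 | s in U K ((2 ^ n + 1) %/ 3) & s != 1]].
Proof.
have Y13 : [disjoint Y F 1 & Y F 3].
  by apply/pred0P => xi /=; rewrite !YE; case: eqP => // ->.
split; last exact: iota_Y3.
(* A nonzero value has one or three preimages according to the trace; conversely a fibre of positive
   size is inhabited. *)
- apply/setP => xi; rewrite 2!in_setU in_set1; apply/imsetP/idP => [[x _ ->]|].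
    case: eqVneq => //= x3; have := cubic_Y hodd hF x3.
    by case: ifP => _ ->; rewrite ?orbT.
  case/orP => [/orP[/eqP ->|]|].
  + by exists 0; rewrite // expr0n addr0.
  + by case/Y_preimage => // x ->; exists x.
  + by case/Y_preimage => // x ->; exists x.
- by split=> //; rewrite disjoints1 (Y_0 hF).
- by apply/setP => xi; rewrite (Y1_Tr hodd hF) inE.
Qed.
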